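(* Let $P\subset\mathbb{R}^n$ be a deeply monotone polytope. Then: 1. If $u_1$ and $u_2$ are (distinct) primitive edge vectors of $P$ at the same vertex $v$, then $\mathcal{E}(P)$ contains $u_1$, $u_2$, and at least one of $u_1+u_2$ and $u_1-u_2$. 2. $P$ satisfies the star Ewald condition. 3. $P$ satisfies the strong Ewald condition.
   Context: An $n$-dimensional polytope in $\mathbb{R}^n$ is smooth if it is simple, rational, and the primitive edge-direction vectors at each vertex form a basis of $\mathbb{Z}^n$. A lattice polytope (vertices in $\mathbb{Z}^n$) with the origin in its interior is reflexive if every facet-defining inequality is of the form $u_F\cdot x\le1$ with $u_F\in\mathbb{Z}^n$ the primitive exterior normal of the facet; monotone means smooth and reflexive. The primitive edge vectors at a vertex $v$ are the primitive integer vectors pointing from $v$ along its edges. A smooth lattice polytope $P$ is deeply smooth if for every vertex $v$, with primitive edge vectors $u_1,\dots,u_n$ at $v$, $P$ contains $\{v+\sum_{i=1}^n\lambda_iu_i:\lambda_i\in[0,1]\ \forall i\}$. Deeply monotone means deeply smooth and monotone. The Ewald set is $\mathcal{E}(P):=\mathbb{Z}^n\cap P\cap(-P)$. For a face $f$ of $P$, $\operatorname{Star}(f)$ is the union of all facets containing $f$, $\operatorname{star}(f)$ the union of all codimension-two faces of $P$ containing $f$, and $\operatorname{Star}^*(f)=\operatorname{Star}(f)\setminus\operatorname{star}(f)$. Strong Ewald condition: for each facet $F$ of $P$ the set $\mathcal{E}(P)\cap F$ contains a $\mathbb{Z}$-basis of $\mathbb{Z}^n$. Star Ewald condition: for every nonempty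 proper face $f$ of $P$ there exists $\lambda\in\mathcal{E}(P)$ with $\lambda\in\operatorname{Star}^*(f)$ and $-\lambda\notin\operatorname{Star}(f)$. *)

(* Defs.v *)
From HB Require Import structures.
From mathcomp Require Import all_boot all_order all_algebra.
From mathcomp Require Import boolp classical_sets functions cardinality.
From mathcomp Require Import reals topology normedtype.

Set Implicit Arguments.
Unset Strict Implicit.
Unset Printing Implicit Defensive.

Import Order.TTheory GRing.Theory Num.Theory.
Import numFieldNormedType.Exports.
Local Open Scope classical_set_scope.
Local Open Scope ring_scope.

(* Points of R^n are row vectors 'rV[R]_n, elements of Z^n are 'rV[int]_n; a
   finite family of vectors is the matrix having them as rows. *)

Definition of_int (R : realType) (m n : nat) (A : 'M[int]_(m, n)) : 'M[R]_(m, n) :=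
  map_mx intr A.
Arguments of_int {R m n} A.

Definition dot (R : realType) (n : nat) (c x : 'rV[R]_n) : R :=
  \sum_(i < n) c 0 i * x 0 i.

Definition lattice (R : realType) (n : nat) : set 'rV[R]_n :=
  range (@of_int R 1 n).
Arguments lattice R n : clear implicits.

Definition primitive (n : nat) (u : 'rV[int]_n) : Prop :=
  \big[gcdn/0%N]_(i < n) absz (u 0 i) = 1%N.

Definition zbasis (n : nat) (B : 'M[int]_n) : Prop :=
  forall z : 'rV[int]_n, exists! c : 'rV[int]_n, z = c *m B.

Definition conv_hull (R : realType) (n k : nat) (V : 'M[R]_(k, n)) : set 'rV[R]_n :=
  [set x | exists w : 'rV[R]_k,
     [/\ forall i, 0 <= w 0 i, \sum_(i < k) w 0 i = 1 & x = w *m V]].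

Definition aff_hull (R : realType) (n : nat) (A : set 'rV[R]_n) : set 'rV[R]_n :=
  [set x | exists (k : nat) (V : 'M[R]_(k, n)) (w : 'rV[R]_k),
     [/\ forall i, A (row i V), \sum_(i < k) w 0 i = 1 & x = w *m V]].

(* The affine hull of A is a translate of a d-dimensional linear subspace; in
   particular A is nonempty. *)
Definition has_dim (R : realType) (n : nat) (A : set 'rV[R]_n) (d : nat) : Prop :=
  exists (x : 'rV[R]_n) (B : 'M[R]_(d, n)),
    row_free B /\ aff_hull A = [set y | (y - x <= B)%MS].

Section Polytopes.
Variables (R : realType) (n : nat).
Implicit Types (P F f e : set 'rV[R]_n) (v x : 'rV[R]_n) (u : 'rV[int]_n).

Definition polytope P : Prop :=
  exists (k : nat) (V : 'M[R]_(k, n)), P = conv_hull V.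

(* c = 0 yields the two improper faces P and set0. *)
Definition face P f : Prop :=
  exists (c : 'rV[R]_n) (b : R),
    (forall x, P x -> dot c x <= b) /\ f = P `&` [set x | dot c x = b].

Definition vertex P v : Prop := face P [set v].

Definition edge P e : Prop := face P e /\ has_dim e 1.

(* Codimension in R^n, hence in P as soon as P is full-dimensional. *)
Definition face_codim P (k : nat) F : Prop :=
  face P F /\ exists d : nat, (d + k)%N = n /\ has_dim F d.

Definition facet P F : Prop := face_codim P 1 F.

Definition edge_vector P v u : Prop :=
  primitive u /\ exists e, [/\ edge P e, e v &
    exists t : R, 0 < t /\ e (v + t *: of_int u)].

Definition edge_frame P v (U : 'M[int]_n) : Prop :=
  injective (fun i => row i U) /\
  forall u, edge_vector P v u <-> exists i, u = row i U.

Definition simple_polytope P : Prop :=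
  forall v, vertex P v -> ([set e | edge P e /\ e v] #= `I_n)%card.

Definition rational_polytope P : Prop :=
  forall e, edge P e -> exists2 u, u != 0 &
    forall x y, e x -> e y -> exists t : R, y - x = t *: of_int u.

Definition smooth P : Prop :=
  [/\ polytope P, has_dim P n, simple_polytope P, rational_polytope P &
      forall v, vertex P v -> exists U, edge_frame P v U /\ zbasis U].

Definition lattice_polytope P : Prop :=
  polytope P /\ forall v, vertex P v -> lattice R n v.

Definition reflexive_polytope P : Prop :=
  [/\ lattice_polytope P, interior P 0 &
      forall F, facet P F -> exists u,
        [/\ primitive u, forall x, P x -> dot (of_int u) x <= 1 &
            F = P `&` [set x | dot (of_int u) x = 1]]].

Definition monotone_polytope P : Prop := smooth P /\ reflexive_polytope P.

Definition deeply_smooth P : Prop :=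
  [/\ smooth P, lattice_polytope P &
      forall v U, vertex P v -> edge_frame P v U ->
        forall l : 'rV[R]_n, (forall i, 0 <= l 0 i <= 1) ->
          P (v + \sum_(i < n) l 0 i *: of_int (row i U))].

Definition deeply_monotone P : Prop := deeply_smooth P /\ monotone_polytope P.

Definition Ewald P : set 'rV[R]_n :=
  lattice R n `&` P `&` [set x | P (- x)].

Definition Star P f : set 'rV[R]_n :=
  \bigcup_(F in [set F | facet P F /\ f `<=` F]) F.

Definition star P f : set 'rV[R]_n :=
  \bigcup_(F in [set F | face_codim P 2 F /\ f `<=` F]) F.

Definition Star_star P f : set 'rV[R]_n := Star P f `\` star P f.

Definition strong_Ewald P : Prop :=
  forall F, facet P F -> exists B : 'M[int]_n,
    zbasis B /\ forall i, (Ewald P `&` F) (of_int (row i B)).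

Definition star_Ewald P : Prop :=
  forall f, face P f -> f !=set0 -> f <> P ->
    exists l, [/\ Ewald P l, Star_star P f l & ~ Star P f (- l)].

End Polytopes.

(* Main.v *)
Require Import Defs.
From HB Require Import structures.
From mathcomp Require Import all_boot all_order all_algebra.
From mathcomp Require Import boolp classical_sets functions cardinality.
From mathcomp Require Import reals topology normedtype.
From mathcomp Require Import ring lra zify.

Set Implicit Arguments.
Unset Strict Implicit.
Unset Printing Implicit Defensive.

Import Order.TTheory GRing.Theory Num.Theory.
Import numFieldNormedType.Exports.
Local Open Scope classical_set_scope.
Local Open Scope ring_scope.

(** At a vertex [v] of [P] let [u_1, ..., u_n] be the primitive edge vectors.
    If [v] does not maximize a linear form on [P], then the form increases along
    some edge at [v] ([ascending_edge]), so [P] lies in the cone [v + cone(u_i)]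
    ([tangent_cone]). In the coordinates given by the basis [u_i], the facets at
    [v] are therefore the coordinate hyperplanes through [v], and reflexivity
    says that the origin is at lattice distance one from each of them:
    [v = - (u_1 + ... + u_n)]. Deep smoothness now puts into [P] the cube spanned
    by the [- u_i], which has [v] and the origin as opposite corners
    ([vertex_corner]). Nearly everything is read off such cubes.

    - [- u_i] is in [P]. The edge in direction [u_i] ends at a vertex [w] having
      [- u_i] as an edge vector, and the cube at [w] gives [u_i] in [P]
      ([opposite_vertex], [edge_vector_pm]).

    - The cube at [v] gives [- u_1 - u_2] in [P]. At the other end [w] of the edge
      along [u_1], the polygonal face through [v] spanned by [u_1] and [u_2] has
      edge vectors [- u_1] and [u_2 + k u_1] for some integer [k]
      ([polygon_neighbour]). If [k = 0] the cube at [w] gives [u_1 - u_2] in [P].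
      Otherwise [u_2 + u_1] or [- u_2 + u_1] lies on a segment between points of
      [P] already found. Exchanging [u_1] and [u_2] gives either [u_1 + u_2] in
      [P] or both of [u_1 - u_2] and [u_2 - u_1].

    - A face through [v] is cut out of [P] by the vanishing of some of the
      coordinates centred at [v] ([face_at_corner]). If [v] is a vertex of a
      proper face [f], and [F_p] is a coordinate facet containing [f], then
      [- u_p] lies on [F_p] and on no other coordinate hyperplane through [v],
      while [u_p] lies on none of them; this is the star condition.

    - A facet through [v] contains some coordinate facet [F_p], and the points
      [- u_p] and [- u_p + e_j u_j], with suitable signs [e_j], form a basis of
      the lattice made of points of the Ewald set on [F_p]. *)

(** * Linear forms on convex hulls *)

Lemma dotE (R : realType) (n : nat) (c x : 'rV[R]_n) :
  dot c x = (x *m c^T) 0 0.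
Proof. by rewrite mxE; apply: eq_bigr => i _; rewrite mxE mulrC. Qed.

Lemma dotDr (R : realType) (n : nat) (c x y : 'rV[R]_n) :
  dot c (x + y) = dot c x + dot c y.
Proof. by rewrite !dotE mulmxDl mxE. Qed.

Lemma dotNr (R : realType) (n : nat) (c x : 'rV[R]_n) : dot c (- x) = - dot c x.
Proof. by rewrite !dotE mulNmx mxE. Qed.

Lemma dotBr (R : realType) (n : nat) (c x y : 'rV[R]_n) :
  dot c (x - y) = dot c x - dot c y.
Proof. by rewrite dotDr dotNr. Qed.

Lemma dotZr (R : realType) (n : nat) (t : R) (c x : 'rV[R]_n) :
  dot c (t *: x) = t * dot c x.
Proof. by rewrite !dotE -scalemxAl mxE. Qed.

Lemma dotC (R : realType) (n : nat) (c x : 'rV[R]_n) : dot c x = dot x c.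
Proof. by apply: eq_bigr => i _; rewrite mulrC. Qed.

Lemma dotDl (R : realType) (n : nat) (c d x : 'rV[R]_n) :
  dot (c + d) x = dot c x + dot d x.
Proof. by rewrite !(dotC _ x) dotDr. Qed.

Lemma dotZl (R : realType) (n : nat) (t : R) (c x : 'rV[R]_n) :
  dot (t *: c) x = t * dot c x.
Proof. by rewrite !(dotC _ x) dotZr. Qed.

Lemma dot_comb (R : realType) (n k : nat) (c : 'rV[R]_n) (w : 'rV[R]_k)
    (V : 'M[R]_(k, n)) :
  dot c (w *m V) = \sum_(i < k) w 0 i * dot c (row i V).
Proof.
rewrite dotE -mulmxA mxE; apply: eq_bigr => i _; congr (_ * _).
by rewrite dotE -row_mul [in RHS]mxE.
Qed.

Lemma comb_sub (R : realType) (n k : nat) (w : 'rV[R]_k) (V : 'M[R]_(k, n))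
    (x : 'rV[R]_n) : \sum_(i < k) w 0 i = 1 ->
  w *m V - x = \sum_i w 0 i *: (row i V - x).
Proof.
move=> w1; under [RHS]eq_bigr => i _ do rewrite scalerBr.
by rewrite sumrB -scaler_suml w1 scale1r mulmx_sum_row.
Qed.

Lemma dot_eq0 (R : realType) (n : nat) (x : 'rV[R]_n) : dot x x = 0 -> x = 0.
Proof.
move/eqP; rewrite psumr_eq0 => [/allP h|i _]; last by rewrite -expr2 sqr_ge0.
apply/rowP => i; rewrite mxE; have := h i; rewrite mem_index_enum => /(_ isT).
by rewrite mulf_eq0 orbb => /eqP.
Qed.

Lemma dot_self_ge0 (R : realType) (n : nat) (x : 'rV[R]_n) : 0 <= dot x x.
Proof. by apply: sumr_ge0 => i _; rewrite -expr2 sqr_ge0. Qed.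

Lemma dot_selfB (R : realType) (n : nat) (x y : 'rV[R]_n) :
  dot (x - y) (x - y) = dot x x - 2 * dot y x + dot y y.
Proof. by rewrite dotBr !(dotC (x - y)) !dotBr (dotC x); ring. Qed.

(** A point of largest norm in a set is exposed, by the linear form it defines
    (Cauchy-Schwarz with its equality case). Choosing such points yields unique
    maximizers without any genericity argument. *)
Lemma dot_norm_max (R : realType) (n : nat) (x y : 'rV[R]_n) :
  dot x x <= dot y y -> dot y x <= dot y y /\ (dot y x = dot y y -> x = y).
Proof.
move=> xy; have := dot_self_ge0 (x - y); rewrite dot_selfB => h.
split=> [|e]; first lra.
by apply/eqP; rewrite -subr_eq0; apply/eqP/dot_eq0; rewrite dot_selfB; lra.
Qed.

Lemma ex_argmax (R : realType) (I : finType) (p : pred I) (F : I -> R) (i0 : I) :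
  p i0 -> exists2 i, p i & forall j, p j -> F j <= F i.
Proof.
move=> pi0; case: (@arg_maxP _ _ _ i0 p F pi0) => i pi hi.
by exists i => // j pj; apply: hi.
Qed.

(** A finite family can be maximized lexicographically by one linear
    combination, since a large enough multiple of [h1] dominates [h2] wherever
    [h1] is nonzero. This is what makes a face of a face a face. *)
Lemma lex_combination (R : realType) (I : finType) (h1 h2 : I -> R) :
  (forall i, h1 i <= 0) -> (forall i, h1 i = 0 -> h2 i <= 0) ->
  exists N : R, forall i, N * h1 i + h2 i <= 0 /\
    (N * h1 i + h2 i = 0 -> h1 i = 0 /\ h2 i = 0).
Proof.
move=> h1le h2le; exists (1 + \sum_i `|h2 i| / `|h1 i|) => i.
have [h10|h1n0] := eqVneq (h1 i) 0.
  by rewrite h10 mulr0 add0r; split=> //; apply: h2le.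
have h1lt : h1 i < 0 by rewrite lt_neqAle h1n0 h1le.
suff lt0 : (1 + \sum_j `|h2 j| / `|h1 j|) * h1 i + h2 i < 0.
  by split; [exact: ltW | move=> e; rewrite e ltxx in lt0].
(* The sum bounds each single ratio, and 1 makes the inequality strict. *)
set s := \sum_j _.
have le_s : `|h2 i| / `|h1 i| <= s.
  rewrite /s (bigD1 i) //= lerDl; apply: sumr_ge0 => j _.
  by rewrite divr_ge0.
have : `|h2 i| <= s * - h1 i.
  by rewrite -(ler0_norm (h1le i)) -ler_pdivrMr // normr_gt0.
have := ler_norm (h2 i).
lra.
Qed.

Lemma conv_row (R : realType) (n k : nat) (V : 'M[R]_(k, n)) (i : 'I_k) :
  conv_hull V (row i V).
Proof.
exists (delta_mx 0 i); split=> [j||]; last by rewrite -rowE.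
  by rewrite mxE; case: (_ && _).
rewrite (bigD1 i) //= big1 => [|j ji]; first by rewrite mxE !eqxx addr0.
by rewrite mxE (negbTE ji) andbF.
Qed.

Lemma conv_convex (R : realType) (n k : nat) (V : 'M[R]_(k, n)) (t : R)
    (x y : 'rV[R]_n) : 0 <= t <= 1 ->
  conv_hull V x -> conv_hull V y -> conv_hull V (t *: x + (1 - t) *: y).
Proof.
move=> /andP[t0 t1] [a [a0 a1 ->]] [b [b0 b1 ->]].
exists (t *: a + (1 - t) *: b); split.
- by move=> i; rewrite !mxE addr_ge0 // mulr_ge0 // subr_ge0.
- under eq_bigr => i _ do rewrite !mxE.
  by rewrite big_split /= -!mulr_sumr a1 b1 !mulr1; ring.
- by rewrite mulmxDl -!scalemxAl.
Qed.

Lemma dot_comb_sub (R : realType) (n k : nat) (c : 'rV[R]_n) (b : R)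
  (w : 'rV[R]_k) (V : 'M[R]_(k, n)) : \sum_(i < k) w 0 i = 1 ->
  dot c (w *m V) - b = \sum_(i < k) w 0 i * (dot c (row i V) - b).
Proof.
move=> w1; rewrite dot_comb -[X in _ - X = _]mul1r -w1 mulr_suml -sumrB.
by apply: eq_bigr => i _; rewrite mulrBr.
Qed.

Lemma conv_le (R : realType) (n k : nat) (V : 'M[R]_(k, n)) (c : 'rV[R]_n) (b : R) :
  (forall i, dot c (row i V) <= b) -> forall x, conv_hull V x -> dot c x <= b.
Proof.
move=> le x [w [w0 w1 ->]]; rewrite -subr_le0 dot_comb_sub //.
by apply: sumr_le0 => i _; rewrite mulr_ge0_le0 // subr_le0.
Qed.

(** A weighted average of numbers at most [b] equals [b] only if every
    number of nonzero weight does; hence a face of a polytope is the convex hull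
    of the generators on it. *)
Lemma conv_tight (R : realType) (n k : nat) (V : 'M[R]_(k, n)) (c : 'rV[R]_n)
    (b : R) (w : 'rV[R]_k) :
  (forall i, dot c (row i V) <= b) -> (forall i, 0 <= w 0 i) ->
  \sum_(i < k) w 0 i = 1 -> dot c (w *m V) = b ->
  forall i, w 0 i != 0 -> dot c (row i V) = b.
Proof.
move=> le w0 w1 /eqP; rewrite -subr_eq0 dot_comb_sub // -oppr_eq0 -sumrN.
rewrite psumr_eq0 => [/allP h i wi|i _]; last first.
  by rewrite oppr_ge0 mulr_ge0_le0 // subr_le0.
have := h i; rewrite mem_index_enum => /(_ isT).
by rewrite oppr_eq0 mulf_eq0 (negbTE wi) subr_eq0 => /eqP.
Qed.

Lemma face_has_row (R : realType) (n k : nat) (V : 'M[R]_(k, n)) (c : 'rV[R]_n)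
    (b : R) (x : 'rV[R]_n) :
  (forall i, dot c (row i V) <= b) -> conv_hull V x -> dot c x = b ->
  exists i, dot c (row i V) = b.
Proof.
move=> le [w [w0 w1 ->]] e.
have [i wi] : exists i, w 0 i != 0.
  apply/existsP; apply: contraT; rewrite negb_exists => /forallP h.
  suff : (1 : R) = 0 by move/eqP; rewrite oner_eq0.
  by rewrite -w1 big1 // => i _; apply/eqP; have := h i; rewrite negbK.
by exists i; apply: (conv_tight le w0 w1 e).
Qed.

(** Two-stage maximization, first of [c] and then of [d], is maximization
    of the single form [N *: c + d] for a large [N]. *)
Lemma vertex_of_face (R : realType) (n k : nat) (V : 'M[R]_(k, n)) (c d : 'rV[R]_n)
    (b : R) (i0 : 'I_k) :
  (forall i, dot c (row i V) <= b) -> dot c (row i0 V) = b ->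
  (forall i, dot c (row i V) = b -> dot d (row i V) <= dot d (row i0 V)) ->
  (forall i, dot c (row i V) = b -> dot d (row i V) = dot d (row i0 V) ->
     row i V = row i0 V) ->
  vertex (conv_hull V) (row i0 V).
Proof.
move=> le e0 dle deq.
have [||N hN] := @lex_combination R 'I_k (fun i => dot c (row i V) - b)
   (fun i => dot d (row i V) - dot d (row i0 V)).
- by move=> i; rewrite subr_le0.
- by move=> i /eqP; rewrite !subr_eq0 subr_le0 => /eqP /dle.
pose q := N *: c + d; pose B := N * b + dot d (row i0 V).
have qE x : dot q x - B = N * (dot c x - b) + (dot d x - dot d (row i0 V)).
  by rewrite dotDl dotZl /B; ring.
have qle i : dot q (row i V) <= B by rewrite -subr_le0 qE; case: (hN i).
exists q, B; split; first exact: conv_le.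
apply/seteqP; split=> [x /= ->|x /= [[w [w0 w1 ->]] e]].
  split; first exact: conv_row.
  by apply/eqP; rewrite -subr_eq0 qE e0 !subrr mulr0 addr0.
rewrite mulmx_sum_row -[RHS]scale1r -w1 scaler_suml; apply: eq_bigr => i _.
have [->|wi] := eqVneq (w 0 i) 0; first by rewrite !scale0r.
congr (_ *: _); have /eqP := conv_tight qle w0 w1 e wi.
rewrite -subr_eq0 qE => /eqP; case: (hN i) => _ h /h [/eqP + /eqP].
by rewrite !subr_eq0 => /eqP + /eqP; apply: deq.
Qed.

Lemma polytope_convex_step (R : realType) (n : nat) (P : set 'rV[R]_n)
    (x d : 'rV[R]_n) (k : R) :
  polytope P -> 1 <= k -> P x -> P (x + k *: d) -> P (x + d).
Proof.
move=> [m [V ->]] k1 Px Pxk; have k0 : 0 < k by apply: lt_le_trans k1.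
have -> : x + d = k^-1 *: (x + k *: d) + (1 - k^-1) *: x.
  by apply/rowP => i; rewrite !mxE; field; rewrite gt_eqF.
by apply: conv_convex => //; rewrite invr_ge0 ltW //= invf_le1.
Qed.

Lemma face_vertex (R : realType) (n : nat) (P f : set 'rV[R]_n) :
  polytope P -> face P f -> f !=set0 -> exists2 v, vertex P v & f v.
Proof.
move=> [k [V ->]] [c [b [cle ->]]] [x [Px cx]].
have rle i : dot c (row i V) <= b by apply/cle/conv_row.
have [i ci] := face_has_row rle Px cx.
have [i0 /eqP c0 max0] := @ex_argmax R _ (fun i => dot c (row i V) == b)
  (fun i => dot (row i V) (row i V)) i (introT eqP ci).
exists (row i0 V); last by split; [exact: conv_row | exact: c0].
by apply: (vertex_of_face (d := row i0 V) rle c0) => j /eqP/max0/dot_norm_max[].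
Qed.

(** * Dimension of sets *)

(** The points [x] and [x + row j B] are [d + 1] affinely independent
    points of [A], so they already span the flat that contains [A]. *)
Lemma has_dim_intro (R : realType) (n d : nat) (A : set 'rV[R]_n)
    (x : 'rV[R]_n) (B : 'M[R]_(d, n)) :
  row_free B -> A x -> (forall j, A (x + row j B)) ->
  (forall y, A y -> (y - x <= B)%MS) -> has_dim A d.
Proof.
move=> freeB Ax AxB AB; exists x, B; split=> //; apply/seteqP; split=> y /=.
  move=> [k [V [w [AV w1 ->]]]].
  rewrite comb_sub //; apply: summx_sub => i _; exact/scalemx_sub/AB.
move=> /submxP[D yD].
exists (1 + d)%N, (col_mx x (\matrix_j (x + row j B))),
  (row_mx (1 - \sum_j D 0 j)%:M D); split.
- by move=> i; case: (split_ordP i) => j ->; rewrite ?rowKu ?rowKd ?rowK ?row_id.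
- rewrite big_split_ord /= big_ord1 row_mxEl mxE eqxx mulr1n.
  under [X in _ + X]eq_bigr => j _ do rewrite row_mxEr.
  by rewrite subrK.
- rewrite mul_row_col mul_scalar_mx (mulmx_sum_row D).
  under [X in _ + X]eq_bigr => j _ do rewrite rowK scalerDr.
  rewrite big_split /= -scaler_suml -mulmx_sum_row -yD.
  by rewrite scalerBl scale1r addrA subrK addrC subrK.
Qed.

Lemma aff_hull_sub (R : realType) (n : nat) (A : set 'rV[R]_n) : A `<=` aff_hull A.
Proof.
move=> y Ay; exists 1%N, y, 1%:M; split; last by rewrite mul1mx.
  by move=> i; rewrite row_id.
by rewrite big_ord1 mxE eqxx.
Qed.

Lemma has_dim_sub (R : realType) (n d : nat) (A : set 'rV[R]_n) : has_dim A d ->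
  exists2 B : 'M[R]_(d, n), row_free B & forall x y, A x -> A y -> (y - x <= B)%MS.
Proof.
move=> [x0 [B [freeB AB]]]; exists B => // x y /aff_hull_sub + /aff_hull_sub.
rewrite AB /= => hx hy.
have -> : y - x = (y - x0) - (x - x0) by rewrite opprB addrA subrK.
by apply: addmx_sub => //; rewrite eqmx_opp.
Qed.

Lemma has_dim_nonempty (R : realType) (n d : nat) (A : set 'rV[R]_n) :
  has_dim A d -> A !=set0.
Proof.
move=> [x [B [_ AB]]]; have : aff_hull A x by rewrite AB /= subrr sub0mx.
move=> [[|k] [V [w [AV w1 _]]]]; last by exists (row ord0 V); apply: AV.
by move: w1; rewrite big_ord0 => /eqP; rewrite eq_sym oner_eq0.
Qed.

Lemma has_dim_ge (R : realType) (n d m : nat) (A : set 'rV[R]_n) (x : 'rV[R]_n)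
    (B : 'M[R]_(m, n)) :
  has_dim A d -> row_free B -> A x -> (forall j, A (x + row j B)) -> (m <= d)%N.
Proof.
move=> /has_dim_sub[B0 /eqP free0 AB0] /eqP freeB Ax AxB.
rewrite -freeB -free0; apply: mxrankS; apply/row_subP => j.
by have := AB0 _ _ Ax (AxB j); rewrite addrC addKr.
Qed.

Lemma has_dim_le (R : realType) (n d m : nat) (A : set 'rV[R]_n) (x : 'rV[R]_n)
    (B : 'M[R]_(m, n)) :
  has_dim A d -> (forall y, A y -> (y - x <= B)%MS) -> (d <= m)%N.
Proof.
move=> [x0 [B0 [/eqP free0 AB0]]] AB.
have hull y : aff_hull A y -> (y - x <= B)%MS.
  move=> [k [V [w [AV w1 ->]]]].
  by rewrite comb_sub //; apply: summx_sub => i _; apply/scalemx_sub/AB.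
rewrite -free0; apply: leq_trans (rank_leq_row B); apply: mxrankS.
apply/row_subP => j.
have h0 : (x0 - x <= B)%MS by apply: hull; rewrite AB0 /= subrr sub0mx.
have hj : (x0 + row j B0 - x <= B)%MS.
  by apply: hull; rewrite AB0 /= addrC addKr row_sub.
have -> : row j B0 = (x0 + row j B0 - x) - (x0 - x) by rewrite opprB addrA subrK addrC addKr.
by apply: addmx_sub => //; rewrite eqmx_opp.
Qed.

Lemma row_free_nz (R : realType) (n : nat) (u : 'rV[R]_n) : u != 0 -> row_free u.
Proof. by rewrite /row_free rank_rV => ->. Qed.

Lemma has_dim1_line (R : realType) (n : nat) (e : set 'rV[R]_n) (x y : 'rV[R]_n) :
  has_dim e 1 -> e x -> e y -> y != x ->
  forall z, e z -> exists t, z = x + t *: (y - x).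
Proof.
move=> /has_dim_sub[B /eqP freeB eB] ex ey yx z ez.
have : (z - x <= y - x)%MS.
  apply: (submx_trans (eB _ _ ex ez)).
  have h := eB _ _ ex ey.
  rewrite -(mxrank_leqif_sup h).2 freeB.
  by have /eqP -> : row_free (y - x) by apply: row_free_nz; rewrite subr_eq0.
by move=> /sub_rVP[t e0]; exists t; rewrite -e0 addrC subrK.
Qed.

(** * Edges at a vertex *)

Lemma vertex_mem (R : realType) (n : nat) (P : set 'rV[R]_n) (v : 'rV[R]_n) :
  vertex P v -> P v.
Proof. by move=> [c [b [_ vE]]]; have [] : (P `&` [set x | dot c x = b]) v by rewrite -vE. Qed.

Lemma vertex_exposed (R : realType) (n : nat) (P : set 'rV[R]_n) (v : 'rV[R]_n) :
  vertex P v -> exists c b, dot c v = b /\ forall x, P x -> x != v -> dot c x < b.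
Proof.
move=> vert; have [c [b [cle vE]]] := vert; exists c, b; split.
  by have [] : (P `&` [set x | dot c x = b]) v by rewrite -vE.
move=> x Px xv; rewrite lt_neqAle cle // andbT.
apply: contraNneq xv => e; apply/eqP.
suff : [set v] x by [].
by rewrite vE.
Qed.

(** Divide each [row i V - v] by its depth below [v] for a form exposing
    [v]: this is the vertex figure of the polytope, and the edges at [v] on the
    face where [g] is maximal are the vertices of the corresponding face of the
    vertex figure. A point of largest norm there is such a vertex. *)
Lemma edge_at_vertex (R : realType) (n k : nat) (V : 'M[R]_(k, n))
    (v g : 'rV[R]_n) (i0 : 'I_k) :
  vertex (conv_hull V) v ->
  (forall i, dot g (row i V) <= dot g v) ->
  dot g (row i0 V) = dot g v -> row i0 V != v ->
  exists e i, [/\ edge (conv_hull V) e, e v, e (row i V), row i V != v &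
                  dot g (row i V) = dot g v].
Proof.
move=> vert gle g0 i0v; have Pv := vertex_mem vert.
have [c0 [b0 [c0v c0lt]]] := vertex_exposed vert.
pose s i := b0 - dot c0 (row i V).
have s_gt0 i : row i V != v -> 0 < s i.
  by move=> iv; rewrite subr_gt0; apply: c0lt iv; apply: conv_row.
pose z i := (s i)^-1 *: (row i V - v).
have zE i : row i V != v -> row i V - v = s i *: z i.
  by move=> iv; rewrite scalerA divff ?scale1r // gt_eqF ?s_gt0.
pose p i := (row i V != v) && (dot g (row i V) == dot g v).
have [i1 /andP[i1v /eqP g1] max1] :
    exists2 i, p i & forall j, p j -> dot (z j) (z j) <= dot (z i) (z i).
  by apply: (@ex_argmax R _ p (fun i => dot (z i) (z i)) i0); rewrite /p i0v g0 eqxx.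
(* This form is nonpositive on the cone over the chosen face of the vertex
   figure and vanishes exactly on the ray through [z i1]. *)
pose q := z i1 + dot (z i1) (z i1) *: c0.
have qE i : row i V != v ->
    dot q (row i V) - dot q v = s i * (dot (z i1) (z i) - dot (z i1) (z i1)).
  move=> iv; rewrite -dotBr dotDl dotZl mulrBr; congr (_ + _).
    by rewrite zE // dotZr.
  by rewrite dotBr c0v -opprB mulrN mulrC.
have zle i : p i -> dot (z i1) (z i) - dot (z i1) (z i1) <= 0 /\
    (dot (z i1) (z i) - dot (z i1) (z i1) = 0 -> z i = z i1).
  move=> /max1/dot_norm_max[le eq]; split; first by rewrite subr_le0.
  by move/eqP; rewrite subr_eq0 => /eqP/eq.
have [||N hN] := @lex_combination R 'I_k (fun i => dot g (row i V) - dot g v)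
   (fun i => dot q (row i V) - dot q v).
- by move=> i; rewrite subr_le0.
- move=> i /eqP; rewrite subr_eq0 => gi.
  have [->|iv] := eqVneq (row i V) v; first by rewrite subrr.
  rewrite qE // mulr_ge0_le0 //; first exact/ltW/s_gt0.
  by case: (zle i) => //; rewrite /p iv.
pose c := N *: g + q.
have cE i : dot c (row i V) - dot c v =
    N * (dot g (row i V) - dot g v) + (dot q (row i V) - dot q v).
  by rewrite !dotDl !dotZl; ring.
have cle i : dot c (row i V) <= dot c v by rewrite -subr_le0 cE; case: (hN i).
pose e := conv_hull V `&` [set x | dot c x = dot c v].
have ev : e v by [].
have e1 : e (row i1 V).
  split; first exact: conv_row.
  by apply/eqP; rewrite -subr_eq0 cE g1 qE // !subrr !mulr0 addr0.
exists e, i1; split=> //; split.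
  by exists c, (dot c v); split=> //; apply: conv_le.
apply: (@has_dim_intro _ _ _ _ v (row i1 V - v)) => //.
- by apply: row_free_nz; rewrite subr_eq0.
- by move=> j; rewrite row_id addrC subrK.
move=> _ [[w [w0 w1 ->]] we].
rewrite comb_sub //; apply: summx_sub => i _.
have [->|wi] := eqVneq (w 0 i) 0; first by rewrite scale0r sub0mx.
apply: scalemx_sub.
have [->|iv] := eqVneq (row i V) v; first by rewrite subrr sub0mx.
have /eqP := conv_tight cle w0 w1 we wi.
rewrite -subr_eq0 cE => /eqP; case: (hN i) => _ h /h [/eqP].
rewrite subr_eq0 => gi; rewrite qE // => /eqP.
rewrite mulf_eq0 gt_eqF ?s_gt0 //= => /eqP qi.
have -> : z i = z i1 -> row i V - v = (s i / s i1) *: (row i1 V - v).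
- by move=> zi; rewrite zE // zi scalerA.
- exact: scalemx_sub.
by case: (zle i) => [|_]; [rewrite /p iv gi | apply].
Qed.

(** The simplex method never stops at a vertex that is not optimal. The
    rows of largest ratio of gain in [c] to loss in an exposing form [c0] span,
    with [v], a face all of whose points other than [v] improve [c], and any edge
    of it at [v] will do. *)
Lemma ascending_edge (R : realType) (n k : nat) (V : 'M[R]_(k, n))
    (v c : 'rV[R]_n) (i0 : 'I_k) :
  vertex (conv_hull V) v -> dot c v < dot c (row i0 V) ->
  exists e x, [/\ edge (conv_hull V) e, e v, e x & dot c v < dot c x].
Proof.
move=> vert ci0; have Pv := vertex_mem vert.
have [c0 [b0 [c0v c0lt]]] := vertex_exposed vert.
have s_gt0 i : row i V != v -> 0 < b0 - dot c0 (row i V).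
  by move=> iv; rewrite subr_gt0; apply: c0lt iv; apply: conv_row.
have i0v : row i0 V != v by apply: contraTneq ci0 => ->; rewrite ltxx.
pose r i := (dot c (row i V) - dot c v) / (b0 - dot c0 (row i V)).
have [i1 i1v max1] := @ex_argmax R _ (fun i => row i V != v) r i0 i0v.
have r1_gt0 : 0 < r i1.
  by apply: lt_le_trans (max1 _ i0v); rewrite divr_gt0 ?s_gt0 // subr_gt0.
pose g := c + r i1 *: c0.
have gE x : dot g x - dot g v = dot c x - dot c v - r i1 * (b0 - dot c0 x).
  by rewrite !dotDl !dotZl c0v; ring.
have [i|||e [i [edge_e ev ei iv gi]]] := @edge_at_vertex R n k V v g i1 vert.
- have [->//|iv] := eqVneq (row i V) v.
  rewrite -subr_le0 gE subr_le0 -ler_pdivrMr ?s_gt0 //; exact: max1.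
- by apply/eqP; rewrite -subr_eq0 gE divfK ?subrr // gt_eqF ?s_gt0.
- by [].
exists e, (row i V); split=> //; rewrite -subr_gt0.
have /eqP := gi; rewrite -subr_eq0 gE subr_eq0 => /eqP ->.
by rewrite mulr_gt0 ?s_gt0.
Qed.

(** * Integer vectors and bases *)

Lemma of_int_eq0 (R : realType) (n : nat) (u : 'rV[int]_n) :
  (of_int u == 0 :> 'rV[R]_n) = (u == 0).
Proof.
apply/eqP/eqP => [/rowP h|->]; last by rewrite /of_int map_mx0.
by apply/rowP => i; have := h i; rewrite !mxE => /eqP; rewrite intr_eq0 => /eqP.
Qed.

Lemma of_intN (R : realType) (m n : nat) (A : 'M[int]_(m, n)) :
  of_int (- A) = - of_int A :> 'M[R]_(m, n).
Proof. exact: map_mxN. Qed.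

Lemma of_intD (R : realType) (m n : nat) (A B : 'M[int]_(m, n)) :
  of_int (A + B) = of_int A + of_int B :> 'M[R]_(m, n).
Proof. exact: map_mxD. Qed.

Lemma of_intM (R : realType) (m n p : nat) (A : 'M[int]_(m, n)) (B : 'M[int]_(n, p)) :
  of_int (A *m B) = of_int A *m of_int B :> 'M[R]_(m, p).
Proof. exact: map_mxM. Qed.

Lemma of_int1 (R : realType) (n : nat) : of_int 1%:M = 1%:M :> 'M[R]_n.
Proof. exact: map_mx1. Qed.

Lemma primitive_neq0 (n : nat) (u : 'rV[int]_n) : primitive u -> u != 0.
Proof.
move=> up; apply: contra_eq_neq up => ->.
by rewrite big1 // => i _; rewrite mxE.
Qed.

Lemma primitiveN (n : nat) (u : 'rV[int]_n) : primitive u -> primitive (- u).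
Proof. by move=> up; apply: etrans up; apply: eq_bigr => i _; rewrite mxE abszN. Qed.

Lemma primitive_multiple (n : nat) (u : 'rV[int]_n) : u != 0 ->
  exists (g : nat) (u0 : 'rV[int]_n), [/\ (0 < g)%N, primitive u0 & u = g%:Z *: u0].
Proof.
move=> u0; pose g := \big[gcdn/0%N]_(i < n) absz (u 0 i).
have gdvd i : (g %| absz (u 0%R i))%N by rewrite /g (bigD1 i) //= dvdn_gcdl.
have g_gt0 : (0 < g)%N.
  rewrite lt0n; apply: contra_neq u0 => g0; apply/rowP => i; rewrite mxE.
  by have := gdvd i; rewrite g0 dvd0n absz_eq0 => /eqP.
exists g, (\row_i (u 0%R i %/ g)%Z).
have uE i : u 0 i = g%:Z * (u 0%R i %/ g)%Z.
  by rewrite mulrC divzK // dvdzE.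
split=> //; last by apply/rowP => i; rewrite !mxE.
apply/eqP; rewrite -(eqn_pmul2l g_gt0) muln1.
rewrite (big_morph (muln g) (muln_gcdr g) (muln0 g)); apply/eqP.
by apply: eq_bigr => i _; rewrite mxE [in RHS]uE abszM.
Qed.

Lemma zbasis_inv (n : nat) (U : 'M[int]_n) : zbasis U -> exists C, U *m C = 1%:M.
Proof.
move=> zU.
have h i : exists c : 'rV[int]_n, row i 1%:M = c *m U.
  by have [c [e _]] := zU (row i 1%:M); exists c.
have [c cE] := choice h.
exists (\matrix_i c i); apply: mulmx1C; apply/row_matrixP => i.
by rewrite row_mul rowK cE.
Qed.

Lemma inv_zbasis (n : nat) (U C : 'M[int]_n) : U *m C = 1%:M -> zbasis U.
Proof.
move=> UC z; exists (z *m C); split=> [|c ->]; last by rewrite -mulmxA UC mulmx1.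
by rewrite -mulmxA (mulmx1C UC) mulmx1.
Qed.

Lemma of_int_row (R : realType) (n : nat) (U : 'M[int]_n) (i : 'I_n) :
  of_int (row i U) = delta_mx 0 i *m of_int U :> 'rV[R]_n.
Proof. by rewrite /of_int map_row rowE. Qed.

Lemma of_intK (R : realType) (n : nat) (U C : 'M[int]_n) (m : nat) (A : 'M[R]_(m, n)) :
  U *m C = 1%:M -> A *m of_int U *m of_int C = A.
Proof. by move=> UC; rewrite -mulmxA -of_intM UC of_int1 mulmx1. Qed.

Lemma row_coord (R : realType) (n : nat) (U C : 'M[int]_n) (i j : 'I_n) :
  U *m C = 1%:M -> (of_int (row i U) *m of_int C) 0 j = (i == j)%:R :> R.
Proof. by move=> UC; rewrite -of_intM -row_mul UC row1 !mxE eqxx eq_sym; case: eqP. Qed.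

Lemma neg_row_coord (R : realType) (n : nat) (U C : 'M[int]_n) (i j : 'I_n) :
  U *m C = 1%:M -> (- of_int (row i U) *m of_int C) 0 j = - (i == j)%:R :> R.
Proof. by move=> UC; rewrite mulNmx mxE row_coord. Qed.

Lemma dot_of_int (R : realType) (n : nat) (u w : 'rV[int]_n) :
  dot (of_int u) (of_int w) = ((w *m u^T) 0 0)%:~R :> R.
Proof. by rewrite dotE /of_int map_trmx -map_mxM mxE. Qed.

(** In the dual basis, [u] has the single coordinate [(row i U) . u]; it
    divides all entries of [u], so it is a unit, and its sign is known. *)
Lemma primitive_dual (n : nat) (U C : 'M[int]_n) (u : 'rV[int]_n) (i : 'I_n) :
  U *m C = 1%:M -> primitive u ->
  (forall j, j != i -> (row j U *m u^T) 0 0 = 0) -> (row i U *m u^T) 0 0 <= 0 ->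
  u^T = - col i C.
Proof.
move=> UC up u0 ui; pose y := U *m u^T.
have yE j : y j 0 = (row j U *m u^T) 0 0 by rewrite -row_mul [RHS]mxE.
have uE : u^T = y i 0 *: col i C.
  rewrite -[LHS]mul1mx -(mulmx1C UC) -mulmxA -/y; apply/colP => l.
  rewrite [LHS]mxE [RHS]mxE [X in _ = _ * X]mxE.
  rewrite (bigD1 i) //= big1 => [|j ji]; first by rewrite addr0 mulrC.
  by rewrite yE u0 ?mulr0.
have y1 : absz (y i 0) = 1%N.
  suff : (absz (y i 0%R) %| \big[gcdn/0%N]_(l < n) absz (u 0%R l))%N.
    by rewrite [X in (_ %| X)%N]up dvdn1 => /eqP.
  apply: (big_ind (fun m => absz (y i 0%R) %| m)%N) => [|a b ha hb|l _].
  - exact: dvdn0.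
  - by rewrite dvdn_gcd ha.
  have /colP/(_ l) := uE; rewrite [LHS]mxE [RHS]mxE => ->.
  by rewrite abszM dvdn_mulr.
rewrite uE; have -> : y i 0 = -1 by move: ui; rewrite -yE; move: y1; lia.
by rewrite scaleN1r.
Qed.

(** * Edge vectors and the tangent cone *)

(** Rationality provides the direction of the edge up to scaling; only
    divisibility and sign have to be adjusted. *)
Lemma edge_vector_toward (R : realType) (n : nat) (P e : set 'rV[R]_n)
    (v x : 'rV[R]_n) :
  rational_polytope P -> edge P e -> e v -> e x -> x != v ->
  exists u t, [/\ edge_vector P v u, 0 < t & x = v + t *: of_int u].
Proof.
move=> ratP edge_e ev ex xv; have [u0 u0n eu] := ratP e edge_e.
have [t tE] := eu _ _ ev ex.
have [g [u [g0 up uE]]] := primitive_multiple u0n.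
pose t' := t * g%:R.
have xE : x = v + t' *: of_int u.
  rewrite -[LHS](subrK v) tE addrC uE /t' -scalerA; congr (_ + _ *: _).
  by apply/rowP => i; rewrite !mxE intrM.
have t'n : t' != 0.
  by apply: contraNneq xv => t0; rewrite xE t0 scale0r addr0.
have [t'lt|t'gt|/eqP] := ltgtP t' 0; last by rewrite (negbTE t'n).
- exists (- u), (- t'); rewrite oppr_gt0 of_intN scaleNr scalerN opprK; split=> //.
  split; first exact: primitiveN.
  exists e; split=> //; exists (- t').
  by rewrite oppr_gt0 of_intN scaleNr scalerN opprK -xE.
- exists u, t'; split=> //; split=> //; exists e; split=> //.
  by exists t'; rewrite -xE.
Qed.

(** The far end [w] is the generator on the edge that maximizes the form
    [dot u]; uniqueness holds because the edge lies on a line in direction [u]. *)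
Lemma opposite_vertex (R : realType) (n : nat) (P : set 'rV[R]_n)
    (v : 'rV[R]_n) (u : 'rV[int]_n) :
  polytope P -> edge_vector P v u ->
  exists w t, [/\ vertex P w, 0 < t, w = v + t *: of_int u & edge_vector P w (- u)].
Proof.
move=> [k [V ->]] [up [e [edge_e ev [t [t0 et]]]]].
have u0 : of_int u != 0 :> 'rV[R]_n by rewrite of_int_eq0 primitive_neq0.
have [[c [b [cle eE]]] dim1] := edge_e.
have rle i : dot c (row i V) <= b by apply/cle/conv_row.
have line z : e z -> exists s, z = v + s *: of_int u.
  move=> ez; have [|s ->] := has_dim1_line dim1 ev et _ ez.
    by rewrite addrC -subr_eq0 addrK scaler_eq0 gt_eqF.
  by exists (s * t); rewrite addrAC subrr add0r scalerA.
have [Pt ct] : (conv_hull V `&` [set x | dot c x = b]) (v + t *: of_int u).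
  by rewrite -eE.
have [i ci] := face_has_row rle Pt ct.
have [i0 /eqP c0 max0] := @ex_argmax R _ (fun i => dot c (row i V) == b)
  (fun i => dot (of_int u) (row i V)) i (introT eqP ci).
have erow j : dot c (row j V) = b -> e (row j V).
  by move=> cj; rewrite eE; split=> //; apply: conv_row.
have uu : 0 < dot (of_int u) (of_int u : 'rV[R]_n).
  by rewrite lt_neqAle dot_self_ge0 andbT eq_sym; apply: contraNneq u0 => /dot_eq0 ->.
have [s sE] := line _ (erow _ c0).
have ts : t <= s.
  have : dot (of_int u) (v + t *: of_int u) <= dot (of_int u) (row i0 V).
    have [w [w0 w1 wE]] := Pt.
    rewrite -subr_le0 wE dot_comb_sub //; apply: sumr_le0 => j _.
    have [->|wj] := eqVneq (w 0 j) 0; first by rewrite mul0r.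
    rewrite mulr_ge0_le0 // subr_le0; apply: max0; apply/eqP.
    by apply: (conv_tight rle w0 w1 _ wj); rewrite -wE.
  by rewrite sE !dotDr !dotZr lerD2l ler_pM2r.
have s0 : 0 < s by apply: lt_le_trans ts.
exists (row i0 V), s; split=> //.
- apply: (vertex_of_face (d := of_int u) rle c0) => j cj; first by apply/max0/eqP.
  have [s' s'E] := line _ (erow _ cj).
  by rewrite sE s'E !dotDr !dotZr => /addrI/mulIf -> //; rewrite gt_eqF.
- split; first exact: primitiveN.
  exists e; split=> //; first exact: erow.
  by exists s; rewrite of_intN scalerN sE addrK.
Qed.

Lemma dot_col (R : realType) (n : nat) (M : 'M[R]_n) (i : 'I_n) (x : 'rV[R]_n) :
  dot (col i M)^T x = (x *m M) 0 i.
Proof. by rewrite dotE trmxK !mxE; apply: eq_bigr => j _; rewrite mxE. Qed.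

(** A point of [P] outside the cone would have a negative coordinate [i],
    so some edge at [v] would decrease that coordinate; but edge vectors at [v]
    are basis vectors, whose coordinates are 0 or 1. *)
Lemma tangent_cone (R : realType) (n : nat) (P : set 'rV[R]_n) (v : 'rV[R]_n)
    (U C : 'M[int]_n) :
  polytope P -> rational_polytope P -> vertex P v -> edge_frame P v U ->
  U *m C = 1%:M -> forall x, P x -> forall i, 0 <= ((x - v) *m of_int C) 0 i.
Proof.
move=> [k [V ->]] ratP vert [_ frame] UC x Px i.
pose c : 'rV[R]_n := - (col i (of_int C))^T.
have cE y : dot c y = - (y *m of_int C) 0 i by rewrite -dot_col dotC dotNr dotC.
rewrite mulmxBl mxE [X in _ + X]mxE subr_ge0 -lerN2 -!cE.
apply: conv_le Px => j; rewrite leNgt; apply/negP => lt_j.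
have [e [y [edge_e ev ey lty]]] := ascending_edge vert lt_j.
have [|u [t [/frame[l ->] t0 yE]]] := edge_vector_toward ratP edge_e ev ey.
  by apply: contraTneq lty => ->; rewrite ltxx.
move: lty; rewrite yE dotDr ltrDl dotZr pmulr_rgt0 // cE oppr_gt0.
rewrite -of_intM -row_mul UC row1 !mxE.
by case: (_ && _); rewrite ?ltr10 ?ltxx.
Qed.

(** * Corners of deeply monotone polytopes *)

(** The local picture at a vertex: the columns of [C] are the forms dual to
    the rows of [U], the polytope lies in the orthant with apex [v] of the
    coordinates [x *m of_int C], and it contains the cube with opposite corners
    [v] and the origin. Coordinates are centred at the origin, so [v] is
    [(-1, ..., -1)] and the facets at [v] are where a coordinate is -1. *)
Definition corner (R : realType) (n : nat) (P : set 'rV[R]_n) (v : 'rV[R]_n)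
    (U C : 'M[int]_n) : Prop :=
  [/\ U *m C = 1%:M,
      v = const_mx (-1) *m of_int U,
      forall x, P x -> forall i, -1 <= (x *m of_int C) 0 i &
      forall a : 'rV[R]_n, (forall i, -1 <= a 0 i <= 0) -> P (a *m of_int U)].

Lemma coordB (R : realType) (n : nat) (M : 'M[R]_n) (x y : 'rV[R]_n) (i : 'I_n) :
  ((x - y) *m M) 0 i = (x *m M) 0 i - (y *m M) 0 i.
Proof. by rewrite mulmxBl mxE [X in _ + X]mxE. Qed.

Lemma row_free_rowsub (R : realType) (n m : nat) (U C : 'M[int]_n) (f : 'I_m -> 'I_n) :
  injective f -> U *m C = 1%:M -> row_free (rowsub f (of_int U) : 'M[R]_(m, n)).
Proof.
move=> f_inj UC; apply/row_freeP; exists (colsub f (of_int C)).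
apply/matrixP => i j; rewrite mxE.
have := congr1 (fun A : 'M[R]_n => A (f i) (f j)) (of_intM R U C).
rewrite UC of_int1 !mxE (inj_eq f_inj) => ->.
by apply: eq_bigr => l _; rewrite !mxE.
Qed.

(** The hyperplane supports [P] by the cone condition, and it contains
    [v] together with the [n - 1] points [v + u_j], [j != i]. *)
Lemma coordinate_facet (R : realType) (n : nat) (P : set 'rV[R]_n)
    (v : 'rV[R]_n) (U C : 'M[int]_n) (i : 'I_n) :
  U *m C = 1%:M -> P v -> (forall j, P (v + of_int (row j U))) ->
  (forall x, P x -> 0 <= ((x - v) *m of_int C) 0 i) ->
  facet P (P `&` [set x | ((x - v) *m of_int C) 0 i = 0]).
Proof.
move=> UC Pv Pvu cone; split.
  exists (- (col i (of_int C))^T), (- (v *m of_int C) 0 i).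
  have cE y : dot (- (col i (of_int C))^T) y = - (y *m of_int C) 0 i.
    by rewrite -dot_col dotC dotNr dotC.
  split=> [x /cone|]; first by rewrite cE coordB subr_ge0 lerN2.
  congr (_ `&` _); apply/seteqP; split=> x /=; rewrite cE coordB => /eqP.
    by rewrite subr_eq0 => /eqP ->.
  by rewrite eqr_opp => /eqP ->; rewrite subrr.
exists n.-1; split; first by rewrite addn1 (ltn_predK (ltn_ord i)).
apply: (@has_dim_intro _ _ _ _ v (rowsub (lift i) (of_int U))).
- by apply: row_free_rowsub UC; apply: lift_inj.
- by split=> //=; rewrite subrr mul0mx mxE.
- move=> j; rewrite row_rowsub -map_row; split; first exact: Pvu.
  rewrite /= addrC addKr -of_intM -row_mul UC row1 !mxE eqxx /=.
  by rewrite (negbTE (neq_lift i j)).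
- move=> y [_ /= yi].
  have -> : y - v = (y - v) *m of_int C *m of_int U.
    by rewrite (@of_intK _ _ C U) // (mulmx1C UC).
  rewrite mulmx_sum_row; apply: summx_sub => j _.
  case: (unliftP i j) => [l ->|->]; last by rewrite yi scale0r sub0mx.
  apply: scalemx_sub; have := row_sub l (rowsub (lift i) (of_int U : 'M[R]_n)).
  by rewrite row_rowsub.
Qed.

(** Coordinate [i] vanishes at [v] on a facet, whose normal form with
    right-hand side 1 must be minus the [i]-th dual form by primitivity; so [v]
    has [i]-th coordinate -1. Deep smoothness is the statement about the cube. *)
Lemma vertex_corner (R : realType) (n : nat) (P : set 'rV[R]_n) (v : 'rV[R]_n)
    (U : 'M[int]_n) :
  deeply_monotone P -> vertex P v -> edge_frame P v U -> zbasis U ->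
  exists C, corner P v U C.
Proof.
move=> [[_ _ deep] [[polyP _ _ ratP _] [_ _ refl]]] vert frame /zbasis_inv[C UC].
have cone := tangent_cone polyP ratP vert frame UC.
have Pv := vertex_mem vert.
have cube (l : 'rV[R]_n) : (forall i, 0 <= l 0 i <= 1) -> P (v + l *m of_int U).
  move=> l01; have := deep v U vert frame l l01; congr (P (_ + _)).
  by rewrite mulmx_sum_row; apply: eq_bigr => i _; rewrite /of_int map_row.
have Pvu j : P (v + of_int (row j U)).
  rewrite of_int_row; apply: cube => i; rewrite mxE.
  by case: (i == j); rewrite ?andbT ?andbF /= lexx ler01.
have vC : v *m of_int C = const_mx (-1).
  apply/rowP => i; rewrite mxE.
  have [u [up ule uE]] := refl _ (coordinate_facet UC Pv Pvu (fun x Px => cone x Px i)).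
  have uv : dot (of_int u) v = 1.
    have : (P `&` [set x | ((x - v) *m of_int C) 0 i = 0]) v.
      by split=> //=; rewrite subrr mul0mx mxE.
    by rewrite uE => -[].
  have uC := @primitive_dual n U C u i UC up.
  have /uC : forall j, j != i -> (row j U *m u^T) 0 0 = 0.
    move=> j ji; apply/eqP; rewrite -(intr_eq0 R) -dot_of_int.
    have : (P `&` [set x | ((x - v) *m of_int C) 0 i = 0]) (v + of_int (row j U)).
      split=> //=; rewrite addrC addKr -of_intM -row_mul UC row1 !mxE eqxx /=.
      by rewrite eq_sym (negbTE ji).
    rewrite uE => -[_ /= /eqP].
    by rewrite dotDr uv -subr_eq0 addrC addKr.
  have /[swap]/[apply] : (row i U *m u^T) 0 0 <= 0.
    by rewrite -(lerz0 R) -dot_of_int -(lerD2l (dot (of_int u) v)) addr0 -dotDr uv ule.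
  move=> uT; move: uv; rewrite dotE /of_int map_trmx uT map_mxN mulmxN mxE.
  rewrite map_col; move=> /eqP; rewrite eqr_oppLR => /eqP <-.
  by rewrite !mxE; apply: eq_bigr => j _; rewrite !mxE.
have vE : v = const_mx (-1) *m of_int U.
  by rewrite -vC (@of_intK _ _ C U) // (mulmx1C UC).
exists C; split=> //.
- move=> x Px i; have := cone x Px i.
  by rewrite coordB vC [X in _ - X]mxE subr_ge0.
- move=> a a01; have -> : a = const_mx (-1) + (a + const_mx 1).
    by apply/rowP => i; rewrite !mxE; ring.
  rewrite mulmxDl -vE; apply: cube => i; rewrite !mxE.
  by have := a01 i; lra.
Qed.

Lemma vertex_frame_corner (R : realType) (n : nat) (P : set 'rV[R]_n) (v : 'rV[R]_n) :
  deeply_monotone P -> vertex P v ->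
  exists U C, edge_frame P v U /\ corner P v U C.
Proof.
move=> hP vert; have [[[_ _ _ _ bases] _ _] _] := hP.
have [U [frame zU]] := bases v vert.
by have [C cor] := vertex_corner hP vert frame zU; exists U, C.
Qed.

Lemma corner_mem (R : realType) (n : nat) (P : set 'rV[R]_n) (v : 'rV[R]_n)
    (U C : 'M[int]_n) : corner P v U C ->
  P v /\ forall i, P (v + of_int (row i U)).
Proof.
move=> [_ -> _ cube]; split=> [|i].
  by apply: cube => j; rewrite mxE; lra.
rewrite of_int_row -mulmxDl; apply: cube => j; rewrite !mxE eqxx /=.
by case: eqP => _ /=; lra.
Qed.

Lemma corner_coord (R : realType) (n : nat) (P : set 'rV[R]_n) (v x : 'rV[R]_n)
    (U C : 'M[int]_n) (i : 'I_n) : corner P v U C ->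
  ((x - v) *m of_int C) 0 i = (x *m of_int C) 0 i + 1.
Proof. by move=> [UC -> _ _]; rewrite coordB of_intK // [X in _ - X]mxE opprK. Qed.

(** The form defining [f] is nonpositive on every [u_i], since
    [v + u_i] is in [P]; so it is maximal at a point of [P] exactly when the
    coordinates on which it is negative are all minimal. These form [S]. *)
Lemma face_at_corner (R : realType) (n : nat) (P f : set 'rV[R]_n) (v : 'rV[R]_n)
    (U C : 'M[int]_n) :
  corner P v U C -> face P f -> f v ->
  exists S : {set 'I_n}, forall x,
    f x <-> P x /\ forall i, i \in S -> (x *m of_int C) 0 i = -1.
Proof.
move=> cor [c [b [cle ->]]] [Pv cv]; have [UC _ Cge _] := cor.
have [_ Pvu] := corner_mem cor.
pose D i := dot c (of_int (row i U)).
have Dle i : D i <= 0.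
  by have := cle _ (Pvu i); rewrite dotDr cv gerDl.
have cE x : dot c x - b = \sum_i ((x *m of_int C) 0 i + 1) * D i.
  rewrite -cv -dotBr -[in LHS](@of_intK _ _ C U _ (x - v) (mulmx1C UC)) dot_comb.
  apply: eq_bigr => i _; rewrite (corner_coord _ _ cor) /D; congr (_ * dot _ _).
  by rewrite /of_int map_row.
exists [set i | D i != 0]%SET => x; split=> [[Px /= cx]|[Px xS]]; split=> //.
  move=> i; rewrite inE => Di; have /eqP := cE x.
  rewrite cx subrr eq_sym -oppr_eq0 -sumrN psumr_eq0 => [/allP/(_ i)|j _]; last first.
    by rewrite oppr_ge0 mulr_ge0_le0 //; have := Cge x Px j; lra.
  rewrite mem_index_enum oppr_eq0 mulf_eq0 (negbTE Di) orbF => /(_ isT).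
  by rewrite addr_eq0 => /eqP.
apply/eqP; rewrite /= -subr_eq0 cE big1 // => i _.
have [->|Di] := eqVneq (D i) 0; first by rewrite mulr0.
by rewrite xS ?inE // addrC subrr mul0r.
Qed.

Lemma corner_coordinate_facet (R : realType) (n : nat) (P : set 'rV[R]_n)
    (v : 'rV[R]_n) (U C : 'M[int]_n) (i : 'I_n) :
  corner P v U C -> facet P (P `&` [set x | (x *m of_int C) 0 i = -1]).
Proof.
move=> cor; have [UC _ Cge _] := cor; have [Pv Pvu] := corner_mem cor.
have -> : [set x | (x *m of_int C) 0 i = -1] = [set x | ((x - v) *m of_int C) 0 i = 0].
  by apply/seteqP; split=> x /=; rewrite (corner_coord _ _ cor) => h; lra.
apply: coordinate_facet UC Pv Pvu _ => x Px.
by rewrite (corner_coord _ _ cor); have := Cge x Px i; lra.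
Qed.

Lemma corner_add_coord (R : realType) (n : nat) (P : set 'rV[R]_n)
    (v : 'rV[R]_n) (U C : 'M[int]_n) (i j : 'I_n) : corner P v U C ->
  ((v + of_int (row i U)) *m of_int C) 0 j = (i == j)%:R - 1.
Proof.
move=> [UC -> _ _]; rewrite mulmxDl mxE of_intK // [X in X + _]mxE row_coord //.
by rewrite addrC.
Qed.

(** The facet is cut out by the coordinates in a set [S]. It is not
    all of [P], so [S] is nonempty; two elements of [S] would confine it to
    codimension 2. Thus [S] is the singleton of [p]. *)
Lemma facet_contains_coordinate_facet (R : realType) (n : nat)
    (P F : set 'rV[R]_n) (v : 'rV[R]_n) (U C : 'M[int]_n) :
  corner P v U C -> facet P F -> F v ->
  exists p, forall x, P x -> (x *m of_int C) 0 p = -1 -> F x.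
Proof.
move=> cor [face_F [d [dn dimF]]] Fv.
have [UC _ Cge cube] := cor; have [Pv Pvu] := corner_mem cor.
have [S FS] := face_at_corner cor face_F Fv.
have [p pS] : exists p, p \in S.
  apply/set0Pn; apply/eqP => S0.
  have freeU : row_free (rowsub id (of_int U) : 'M[R]_n) by apply: row_free_rowsub UC.
  have : (n <= d)%N.
    apply: (has_dim_ge dimF freeU Fv) => j.
    rewrite row_rowsub -map_row; apply/FS; split=> [|i]; first exact: Pvu.
    by rewrite S0 inE.
  lia.
exists p => x Px xp; apply/FS; split=> // q qS.
have [<-//|pq] := eqVneq p q.
have [q' qE _] := unlift_some pq.
have : (d <= n.-1.-1)%N.
  apply: (@has_dim_le _ _ _ _ _ v (rowsub (lift p \o lift q') (of_int U)) dimF) => y.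
  move=> /FS[Py yS].
  have -> : y - v = (y - v) *m of_int C *m of_int U.
    by rewrite (@of_intK _ _ C U) // (mulmx1C UC).
  rewrite mulmx_sum_row; apply: summx_sub => j _; rewrite (corner_coord _ _ cor).
  case: (unliftP p j) => [l ->|->]; last by rewrite yS // addrC subrr scale0r sub0mx.
  case: (unliftP q' l) => [l' ->|->]; last first.
    by rewrite -qE yS // addrC subrr scale0r sub0mx.
  apply: scalemx_sub.
  have := row_sub l' (rowsub (lift p \o lift q') (of_int U : 'M[R]_n)).
  by rewrite row_rowsub.
by have := ltn_ord q'; lia.
Qed.

(** * Sums and differences of edge vectors *)

Lemma edge_vector_opp_sum (R : realType) (n : nat) (P : set 'rV[R]_n)
    (v : 'rV[R]_n) (u1 u2 : 'rV[int]_n) :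
  deeply_monotone P -> vertex P v -> edge_vector P v u1 -> edge_vector P v u2 ->
  u1 != u2 -> P (- of_int u1 - of_int u2).
Proof.
move=> hP vert + + u12.
have [U [C [[_ frame] [_ _ _ cube]]]] := vertex_frame_corner hP vert.
move=> /frame[i1 e1] /frame[i2 e2]; subst u1 u2.
have i12 : i1 != i2 by apply: contraNneq u12 => ->.
rewrite !of_int_row -mulNmx -mulmxBl; apply: cube => j; rewrite !mxE !eqxx /=.
case: (eqVneq j i1) => [->|_].
  by rewrite (negbTE i12) mulr0n subr0 mulr1n lexx /=; lra.
by case: eqP => _ /=; lra.
Qed.

Lemma edge_vector_opp (R : realType) (n : nat) (P : set 'rV[R]_n)
    (v : 'rV[R]_n) (u : 'rV[int]_n) :
  deeply_monotone P -> vertex P v -> edge_vector P v u -> P (- of_int u).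
Proof.
move=> hP vert.
have [U [C [[_ frame] [_ _ _ cube]]]] := vertex_frame_corner hP vert.
move=> /frame[i ->]; rewrite of_int_row -mulNmx; apply: cube => j; rewrite !mxE eqxx /=.
by case: eqP => _ /=; lra.
Qed.

(** The vector [- u] belongs to the cube at [v], and [u] to the cube at the
    other end of the edge. *)
Lemma edge_vector_pm (R : realType) (n : nat) (P : set 'rV[R]_n)
    (v : 'rV[R]_n) (u : 'rV[int]_n) :
  deeply_monotone P -> vertex P v -> edge_vector P v u ->
  P (of_int u) /\ P (- of_int u).
Proof.
move=> hP vert eu; split; last exact: edge_vector_opp eu.
have [_ [[polyP _ _ _ _] _]] := hP.
have [w [t [vertw _ _ ew]]] := opposite_vertex polyP eu.
by have := edge_vector_opp hP vertw ew; rewrite of_intN opprK.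
Qed.

Lemma Ewald_pm (R : realType) (n : nat) (P : set 'rV[R]_n) (u : 'rV[int]_n) :
  P (of_int u) -> P (- of_int u) -> Ewald P (of_int u).
Proof. by move=> Pu Pnu; split=> //; split=> //; exists u. Qed.

Lemma Ewald_opp (R : realType) (n : nat) (P : set 'rV[R]_n) (u : 'rV[int]_n) :
  Ewald P (of_int u) -> Ewald P (of_int (- u)).
Proof. by move=> [[_ Pu] Pnu]; apply: Ewald_pm; rewrite of_intN ?opprK. Qed.

Lemma edge_vector_Ewald (R : realType) (n : nat) (P : set 'rV[R]_n)
    (v : 'rV[R]_n) (u : 'rV[int]_n) :
  deeply_monotone P -> vertex P v -> edge_vector P v u -> Ewald P (of_int u).
Proof. by move=> hP vert /(edge_vector_pm hP vert)[Pu Pnu]; apply: Ewald_pm. Qed.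

(** Follow the edge from [v] along [u1] to its end [w]. Relative to [w],
    the point [v + u2] is a nonnegative combination of the edge vectors at [w];
    those edge vectors have nonnegative [U]-coordinates except possibly along
    [u1], so each one used has to lie in the plane of [u1] and [u2], and at least
    one has a positive [u2]-coordinate. That coordinate is 1 because
    [u2] has integral coordinates in the basis at [w]. *)
Lemma polygon_neighbour (R : realType) (n : nat) (P : set 'rV[R]_n)
    (v : 'rV[R]_n) (u1 u2 : 'rV[int]_n) :
  deeply_monotone P -> vertex P v -> edge_vector P v u1 -> edge_vector P v u2 ->
  u1 != u2 -> exists w (k : int), [/\ vertex P w, edge_vector P w (- u1),
     edge_vector P w (u2 + k *: u1) & - u1 != u2 + k *: u1].
Proof.
move=> hP vert eu1 eu2 u12.
have [U [C [[_ frame] [UC vE Cge cube]]]] := vertex_frame_corner hP vert.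
have [_ [[polyP _ _ _ _] _]] := hP.
have [w [t [vertw t0 wE ew]]] := opposite_vertex polyP eu1.
have [U' [C' [[inj' frame'] [UC' wE' Cge' cube']]]] := vertex_frame_corner hP vertw.
have /frame[i1 e1] := eu1; have /frame[i2 e2] := eu2.
have /frame'[j1 f1] := ew.
have i12 : i1 != i2 by apply: contraNneq u12; rewrite e1 e2 => ->.
(* Row [l] of [M] lists the [U]-coordinates of the [l]-th edge vector at [w]. *)
pose M := U' *m C.
have ucE i j : (row i U *m C) 0 j = (i == j)%:R.
  by rewrite -row_mul UC row1 !mxE eqxx eq_sym.
have vC j : (v *m of_int C) 0 j = -1 by rewrite vE of_intK // mxE.
have wC j : j != i1 -> (w *m of_int C) 0 j = -1.
  move=> ji; rewrite wE mulmxDl mxE vC -scalemxAl mxE -of_intM e1 mxE ucE.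
  by rewrite eq_sym (negbTE ji) mulr0 addr0.
have Mge l j : j != i1 -> 0 <= M l j.
  move=> ji; have : P (w + of_int (row l U')).
    rewrite wE' of_int_row -mulmxDl; apply: cube' => i; rewrite !mxE eqxx /=.
    by case: eqP => _ /=; lra.
  move=> /Cge/(_ j); rewrite mulmxDl mxE wC // -of_intM -row_mul !mxE.
  by rewrite lerDl ler0z.
pose x : 'rV[R]_n := v + of_int u2.
have Px : P x.
  rewrite /x vE e2 of_int_row -mulmxDl; apply: cube => i; rewrite !mxE eqxx /=.
  by case: eqP => _ /=; lra.
pose a := (x - w) *m of_int C'.
have a_ge0 l : 0 <= a 0 l.
  rewrite /a coordB wE' of_intK // [X in _ - X]mxE.
  by have := Cge' _ Px l; lra.
have aM j : \sum_l a 0 l * (M l j)%:~R = (i2 == j)%:R - t * (i1 == j)%:R.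
  have : (a *m of_int M) 0 j = ((of_int u2 - t *: of_int u1 : 'rV[R]_n) *m of_int C) 0 j.
    rewrite of_intM mulmxA (_ : a *m _ = x - w); last first.
      by rewrite /a (@of_intK _ _ C' U') // (mulmx1C UC').
    by rewrite /x wE opprD addrACA subrr add0r.
  rewrite mxE; under eq_bigr => l _ do rewrite [X in _ * X]mxE.
  move=> ->; rewrite coordB -scalemxAl [X in _ - X]mxE -!of_intM.
  rewrite [X in X - _]mxE [X in _ - _ * X]mxE e1 e2 !ucE.
  by case: eqP; case: eqP.
(* Nonnegative terms with sum 0. *)
have aM0 l j : j != i1 -> j != i2 -> a 0 l != 0 -> M l j = 0.
  move=> ji1 ji2 al; have := aM j.
  rewrite ![_ == j]eq_sym (negbTE ji1) (negbTE ji2) mulr0 subr0 => /eqP.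
  rewrite psumr_eq0 => [/allP/(_ l)|l' _]; last first.
    by rewrite mulr_ge0 // ler0z Mge.
  by rewrite mem_index_enum mulf_eq0 (negbTE al) intr_eq0 => /(_ isT)/eqP.
have [l al Ml] : exists2 l, a 0 l != 0 & M l i2 != 0.
  have : \sum_l a 0 l * (M l i2)%:~R != 0.
    by rewrite aM eqxx (negbTE i12) mulr0 subr0 oner_eq0.
  case: (pselect (exists2 l, a 0 l != 0 & M l i2 != 0)) => // h.
  rewrite big1 ?eqxx // => l _.
  have [->|al] := eqVneq (a 0 l) 0; first by rewrite mul0r.
  have [->|Ml] := eqVneq (M l i2) 0; first by rewrite mulr0.
  by case: h; exists l.
have rowE' : row l U' = M l i1 *: u1 + M l i2 *: u2.
  have -> : row l U' = row l M *m U by rewrite /M row_mul -mulmxA (mulmx1C UC) mulmx1.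
  rewrite mulmx_sum_row (bigD1 i1) //= (bigD1 i2) 1?eq_sym //= big1 => [|j].
    by rewrite addr0 -e1 -e2 ![(row l M) 0 _]mxE.
  by move=> /andP[j1' j2']; rewrite mxE aM0 // scale0r.
have lj1 : l != j1.
  apply: contraNneq Ml => ->.
  have -> : M j1 i2 = (row j1 U' *m C) 0 i2 by rewrite -row_mul [RHS]mxE.
  by rewrite -f1 mulNmx mxE e1 ucE (negbTE i12).
(* Compare the [l]-th coordinates in the basis at [w]: [u1] has coordinate 0
   because it is minus another basis vector. *)
have Ml1 : M l i2 = 1.
  have := congr1 (fun z => (z *m C') 0 l) rowE'.
  have -> : (row l U' *m C') 0 l = 1 by rewrite -row_mul UC' row1 !mxE !eqxx.
  rewrite mulmxDl -!scalemxAl mxE [X in X + _]mxE [X in _ + X]mxE.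
  have -> : (u1 *m C') 0 l = 0.
    have -> : u1 = - row j1 U' by rewrite -f1 opprK.
    by rewrite mulNmx -row_mul UC' row1 !mxE (negbTE lj1).
  rewrite mulr0 add0r => /(congr1 absz)/esym/eqP; rewrite abszM muln_eq1.
  have := Mge l i2; rewrite eq_sym => /(_ i12).
  by move: (M l i2) => m m0 /andP[/eqP m1 _]; move: m0 m1; lia.
exists w, (M l i1); split=> //.
- by apply/frame'; exists l; rewrite rowE' Ml1 scale1r addrC.
- apply: contraNneq lj1 => h; apply/eqP/inj'.
  by rewrite /= -f1 rowE' Ml1 scale1r addrC h.
Qed.

(** If [k > 0], then [u2 + u1] is between [u2] and [u2 + k u1]; if [k < 0],
    then [- u2 + u1] is between [- u2] and [- u2 - k u1]; if [k = 0], then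
    [u1 - u2] is minus the sum of the two edge vectors at [w]. *)
Lemma sum_or_difference_mem (R : realType) (n : nat) (P : set 'rV[R]_n)
    (v : 'rV[R]_n) (u1 u2 : 'rV[int]_n) :
  deeply_monotone P -> vertex P v -> edge_vector P v u1 -> edge_vector P v u2 ->
  u1 != u2 -> P (of_int u1 + of_int u2) \/ P (of_int u1 - of_int u2).
Proof.
move=> hP vert e1 e2 u12; have [_ [[polyP _ _ _ _] _]] := hP.
have [w [k [vertw ew1 ew2 neq]]] := polygon_neighbour hP vert e1 e2 u12.
have kE : of_int (k *: u1) = k%:~R *: of_int u1 :> 'rV[R]_n.
  by apply/rowP => i; rewrite !mxE intrM.
have [Pk Pnk] := edge_vector_pm hP vertw ew2.
have [P2 Pn2] := edge_vector_pm hP vert e2.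
have [k1|[k0|k1]] : 1 <= k \/ k = 0 \/ 1 <= - k by lia.
- left; rewrite addrC; apply: (polytope_convex_step (k := k%:~R) polyP _ P2).
    by rewrite ler1z.
  by rewrite -kE -of_intD.
- right; have := edge_vector_opp_sum hP vertw ew1 ew2 neq.
  by rewrite k0 scale0r addr0 of_intN opprK.
- right; rewrite addrC; apply: (polytope_convex_step (k := (- k)%:~R) polyP _ Pn2).
    by rewrite ler1z.
  by rewrite mulrNz scaleNr -kE -opprD -of_intD.
Qed.

(** The negative of the sum is always in [P]. If the sum is not, the
    alternative applied to both orders of the two vectors gives both signs of the
    difference. *)
Lemma sum_or_difference_Ewald (R : realType) (n : nat) (P : set 'rV[R]_n)
    (v : 'rV[R]_n) (u1 u2 : 'rV[int]_n) :
  deeply_monotone P -> vertex P v -> edge_vector P v u1 -> edge_vector P v u2 ->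
  u1 != u2 -> Ewald P (of_int (u1 + u2)) \/ Ewald P (of_int (u1 - u2)).
Proof.
move=> hP vert e1 e2 u12.
have Pn := edge_vector_opp_sum hP vert e1 e2 u12.
have [Ps|Pd] := sum_or_difference_mem hP vert e1 e2 u12.
  by left; apply: Ewald_pm; rewrite of_intD // opprD.
rewrite eq_sym in u12.
have [Ps|Pd'] := sum_or_difference_mem hP vert e2 e1 u12.
  by left; apply: Ewald_pm; rewrite of_intD ?opprD // addrC.
by right; apply: Ewald_pm; rewrite of_intD of_intN ?opprB.
Qed.

(** * The Ewald conditions *)

(** The witness is [- u_p], for a coordinate [p] fixed on [f]. Its
    coordinates exceed those of [v] except in position [p], so a face through [v]
    and [- u_p] has codimension at most 1; those of [u_p] all exceed those of
    [v], so no facet contains both [v] and [u_p]. *)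
Lemma deeply_monotone_star (R : realType) (n : nat) (P : set 'rV[R]_n) :
  deeply_monotone P -> star_Ewald P.
Proof.
move=> hP f face_f f0 fP; have [_ [[polyP _ _ _ _] _]] := hP.
have [v vert fv] := face_vertex polyP face_f f0.
have [U [C [[_ frame] cor]]] := vertex_frame_corner hP vert.
have [UC _ Cge cube] := cor; have [Pv Pvu] := corner_mem cor.
have [S fS] := face_at_corner cor face_f fv.
have [p pS] : exists p, p \in S.
  apply/set0Pn; apply: contra_notN fP => /eqP S0.
  apply/seteqP; split=> x; first by move=> /fS[].
  by move=> Px; apply/fS; split=> // i; rewrite S0 inE.
have eup : edge_vector P v (row p U) by apply/frame; exists p.
have [Pu Pnu] := edge_vector_pm hP vert eup.
have freeU : row_free (rowsub id (of_int U) : 'M[R]_n) by apply: row_free_rowsub UC.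
exists (- of_int (row p U)); split.
- by rewrite -of_intN; apply/Ewald_opp/(edge_vector_Ewald hP vert eup).
- split.
    exists (P `&` [set x | (x *m of_int C) 0 p = -1]).
      split; first exact: corner_coordinate_facet cor.
      by move=> x /fS[Px xS]; split=> //; apply: xS.
    by split=> //=; rewrite neg_row_coord // eqxx.
  move=> [G [[face_G [d [dn dimG]]] fG] Gu].
  have [S' GS] := face_at_corner cor face_G (fG _ fv).
  have S'p i : i \in S' -> i = p.
    move=> iS; have [_ /(_ i iS)] := (GS _).1 Gu.
    by rewrite neg_row_coord // => /eqP; rewrite eqr_opp pnatr_eq1 eqb1 => /eqP.
  have : (n.-1 <= d)%N.
    apply: (has_dim_ge dimG (row_free_rowsub R (@lift_inj _ p) UC) (fG _ fv)) => j.
    rewrite row_rowsub -map_row; apply/GS; split=> [|i /S'p ->]; first exact: Pvu.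
    by rewrite (corner_add_coord _ _ cor) eq_sym (negbTE (neq_lift p j)) sub0r.
  by have := ltn_ord p; lia.
- rewrite opprK => -[F [[face_F [d [dn dimF]]] fF] Fu].
  have [S' FS] := face_at_corner cor face_F (fF _ fv).
  have S'0 i : i \notin S'.
    apply/negP => iS; have [_ /(_ i iS)] := (FS _).1 Fu.
    by rewrite row_coord // => h; have := ler0n R (p == i); rewrite h ler0N1.
  have : (n <= d)%N.
    apply: (has_dim_ge dimF freeU (fF _ fv)) => j.
    rewrite row_rowsub -map_row; apply/FS; split=> [|i]; first exact: Pvu.
    by rewrite (negbTE (S'0 i)).
  by lia.
Qed.

(** Subtracting the [p]-th vector from the others leaves the vectors
    [eps j *: row j U]; the matrix [W] performs this elimination. *)
Lemma zbasis_neg_shift (n : nat) (U C : 'M[int]_n) (p : 'I_n) (eps : 'I_n -> int) :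
  U *m C = 1%:M -> (forall j, eps j * eps j = 1) ->
  zbasis (\matrix_j (- row p U + (if j == p then 0 else eps j *: row j U))).
Proof.
move=> UC eps2; set B := \matrix_j _.
pose W : 'M[int]_n := \matrix_j
  (if j == p then - delta_mx 0 p else eps j *: (delta_mx 0 j - delta_mx 0 p)).
have WB : W *m B = U.
  apply/row_matrixP => j; rewrite row_mul rowK.
  have rB i : delta_mx 0 i *m B = - row p U + (if i == p then 0 else eps i *: row i U).
    by rewrite -rowE rowK.
  have [->|jp] := eqVneq j p; first by rewrite mulNmx rB eqxx addr0 opprK.
  rewrite -scalemxAl mulmxBl !rB eqxx (negbTE jp) addr0 [X in _ *: X]addrAC subrr add0r.
  by rewrite scalerA eps2 scale1r.
apply: (@inv_zbasis _ _ (C *m W)); apply: mulmx1C.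
by rewrite -mulmxA WB; apply: mulmx1C.
Qed.

(** The signs are chosen so that each [- u_p + eps_j u_j] is in the Ewald
    set; adding a multiple of [u_j], [j != p], leaves coordinate [p] equal to its
    value -1 at [- u_p]. *)
Lemma deeply_monotone_strong (R : realType) (n : nat) (P : set 'rV[R]_n) :
  deeply_monotone P -> strong_Ewald P.
Proof.
move=> hP F facF; have [_ [[polyP _ _ _ _] _]] := hP.
have [face_F [d [dn dimF]]] := facF.
have [v vert Fv] := face_vertex polyP face_F (has_dim_nonempty dimF).
have [U [C [[inj frame] cor]]] := vertex_frame_corner hP vert.
have [UC _ Cge cube] := cor.
have [p Fp] := facet_contains_coordinate_facet cor facF Fv.
have ev i : edge_vector P v (row i U) by apply/frame; exists i.
pose eps j : int := if `[< Ewald P (of_int (row p U + row j U)) >] then -1 else 1.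
exists (\matrix_j (- row p U + (if j == p then 0 else eps j *: row j U))); split.
  by apply: zbasis_neg_shift UC _ => j; rewrite /eps; case: asboolP.
move=> j; rewrite rowK.
have E : Ewald P (of_int (- row p U + (if j == p then 0 else eps j *: row j U))).
  have [_|jp] := eqVneq j p.
    by rewrite addr0; apply/Ewald_opp/(edge_vector_Ewald hP vert (ev p)).
  have upj : row p U != row j U by apply: contraNneq jp => /inj ->.
  rewrite /eps; case: asboolP => h.
    by rewrite scaleN1r -opprD; apply: Ewald_opp.
  have [//|h'] := sum_or_difference_Ewald hP vert (ev p) (ev j) upj.
  by rewrite scale1r addrC -opprB; apply: Ewald_opp.
split=> //; case: (E) => -[_ PE] _; apply: Fp => //.
rewrite of_intD mulmxDl mxE of_intN neg_row_coord // eqxx.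
suff -> : (of_int (if j == p then 0 else eps j *: row j U) *m of_int C : 'rV[R]_n) 0 p = 0.
  by rewrite addr0.
have [_|jp] := eqVneq j p; first by rewrite -of_intM mul0mx !mxE.
by rewrite -of_intM -scalemxAl -row_mul UC row1 !mxE eqxx eq_sym (negbTE jp) mulr0.
Qed.

Theorem theorem4p14 (R : realType) (n : nat) (P : set 'rV[R]_n)
  (hP : deeply_monotone P) :
  [/\ forall (v : 'rV[R]_n) (u1 u2 : 'rV[int]_n),
        vertex P v -> edge_vector P v u1 -> edge_vector P v u2 -> u1 <> u2 ->
        [/\ Ewald P (of_int u1), Ewald P (of_int u2) &
            Ewald P (of_int (u1 + u2)) \/ Ewald P (of_int (u1 - u2))],
      star_Ewald P &
      strong_Ewald P].
Proof.
split; [|exact: deeply_monotone_star|exact: deeply_monotone_strong].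
move=> v u1 u2 vert e1 e2 /eqP u12; split.
- exact: edge_vector_Ewald e1.
- exact: edge_vector_Ewald e2.
- exact: sum_or_difference_Ewald e1 e2 u12.
Qed.
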